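(* Let $H<H'$ be consecutive highly composite numbers and let $\gamma$ be an $H'$-admissible exponent-lattice geodesic from $H$ to $H'$. Then every interior vertex $z$ of $\gamma$ (i.e. every vertex other than the two endpoints) satisfies $$z<H\qquad\text{and}\qquad d(z)<d(H).$$ If moreover the transition contains both deletions and insertions, then the first move of $\gamma$ is a deletion and the last move of $\gamma$ is an insertion.
   Context: $d(n)$ denotes the number of positive divisors of $n$. A positive integer $H$ is highly composite if $d(m)<d(H)$ for all integers $1\le m<H$. Two highly composite numbers $H<H'$ are consecutive if no highly composite number lies strictly between them. Write $H=\prod_p p^{a_p}$, $H'=\prod_p p^{b_p}$. An exponent-lattice geodesic from $H$ to $H'$ is a sequence of positive integers starting at $H$ and ending at $H'$ in which each step changes the exponent of exactly one prime by one unit, always in the direction of its target exponent (so it has exactly $\sum_p|b_p-a_p|$ steps). A step increasing an exponent (multiplication by a prime) is an insertion; a step decreasing an exponent (division by a prime) is a deletion. The geodesic is $H'$-admissible if every vertex $z$ satisfies $z\le H'$. *)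

(* Defs.v *)
From mathcomp Require Import all_boot.

Set Implicit Arguments.
Unset Strict Implicit.
Unset Printing Implicit Defensive.

Definition num_divisors (n : nat) : nat := size (divisors n).

Definition highly_composite (H : nat) : Prop :=
  0 < H /\ forall m, 1 <= m -> m < H -> num_divisors m < num_divisors H.

Definition consecutive_hc (H H' : nat) : Prop :=
  [/\ highly_composite H, highly_composite H', H < H' &
      forall K, highly_composite K -> ~ (H < K < H')].

(* The direction is read off the current vertex x, so an exponent never moves
   away from, or past, its target in T: a path of such steps from H to T has
   exactly the sum over p of |logn p T - logn p H| steps. *)
Definition exponent_step (T x y : nat) : Prop :=
  exists2 p, prime p &
    (forall q, prime q -> q != p -> logn q y = logn q x) /\
    (logn p x < logn p T /\ logn p y = (logn p x).+1 \/
     logn p T < logn p x /\ logn p x = (logn p y).+1).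

Definition insertion (x y : nat) : Prop := exists2 p, prime p & y = x * p.

Definition deletion (x y : nat) : Prop := exists2 p, prime p & x = y * p.

(* The default value 0 is not a vertex: every use bounds i by size g. *)
Definition vertex (g : seq nat) (i : nat) : nat := nth 0 g i.

Definition geodesic (H H' : nat) (g : seq nat) : Prop :=
  [/\ 0 < size g,
      vertex g 0 = H,
      vertex g (size g).-1 = H',
      forall i, i < size g -> 0 < vertex g i &
      forall i, i.+1 < size g ->
        exponent_step H' (vertex g i) (vertex g i.+1)].

Definition admissible (H' : nat) (g : seq nat) : Prop :=
  forall i, i < size g -> vertex g i <= H'.

Definition has_move (move : nat -> nat -> Prop) (g : seq nat) : Prop :=
  exists2 i, i.+1 < size g & move (vertex g i) (vertex g i.+1).

(* Main.v *)
Require Import Defs.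
From mathcomp Require Import all_boot zify.

Set Implicit Arguments.
Unset Strict Implicit.
Unset Printing Implicit Defensive.

(** If an interior vertex [z] were at least [H], then [H < z < H'], and the
    complementary point [w = H H' / z] would also lie strictly between [H] and
    [H'].  Coordinatewise [z] lies between [H] and [H'], and a product of two
    numbers with fixed sum grows as they approach each other, so
    [d(z) d(w) >= d(H) d(H') > d(H)^2].  But [d <= d(H)] below [H'], since
    [H] and [H'] are consecutive. *)

(** [divisors] folds over [prime_decomp]: a pair [(p, e)] triggers [e] merges, each adding the
    length of the list built from the other primes already treated, so that length is multiplied by
    [e.+1]. *)
Lemma size_divisors n : size (divisors n) = \prod_(p <- primes n) (logn p n).+1.
Proof.
rewrite /divisors -[RHS](big_map (fun p => (p, logn p n)) predT (fun f => f.2.+1)).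
rewrite -prime_decompE; elim: (prime_decomp n) => [|[p e] s IHs].
  by rewrite big_nil.
rewrite big_cons /= -IHs.
elim: e => [|e IHe]; first by rewrite mul1n.
by rewrite /= size_merge size_cat size_map IHe [RHS]mulSn addnC.
Qed.

(** Indices outside [primes n] contribute a factor 1. A range independent of [n] lets several
    divisor counts be compared factor by factor. *)
Lemma num_divisorsE N n : 0 < n -> n < N ->
  num_divisors n = \prod_(0 <= p < N) (logn p n).+1.
Proof.
move=> n_gt0 n_ltN; rewrite /num_divisors size_divisors.
rewrite [RHS](bigID (mem (primes n))) /= [X in _ * X]big1 ?muln1; last first.
  by move=> p; rewrite -logn_gt0 -eqn0Ngt => /eqP ->.
rewrite -[RHS]big_filter; apply: perm_big; apply: uniq_perm.
- exact: primes_uniq.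
- exact/filter_uniq/iota_uniq.
move=> p; rewrite mem_filter mem_index_iota /=.
case: (boolP (p \in primes n)) => //; rewrite mem_primes => /and3P[_ _ p_dv_n].
by rewrite (leq_ltn_trans (dvdn_leq n_gt0 p_dv_n)).
Qed.

Lemma num_divisors_gt0 n : 0 < n -> 0 < num_divisors n.
Proof. by move=> n_gt0; rewrite (@num_divisorsE n.+1) // prodn_gt0. Qed.

(** By strong induction: a least violating [m] would exceed [H] and be highly composite, hence lie
    strictly between [H] and [H']. *)
Lemma num_divisors_consecutive H H' m :
  consecutive_hc H H' -> 0 < m -> m < H' -> num_divisors m <= num_divisors H.
Proof.
case=> [[H_gt0 H_hc] _ _ noHC]; elim/ltn_ind: m => m IHm m_gt0 m_ltH'.
rewrite leqNgt; apply/negP => dH_lt_dm.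
have H_lt_m : H < m.
  rewrite ltnNge leq_eqVlt; apply/negP => /orP[/eqP mH | /(H_hc _ m_gt0)].
    by rewrite mH ltnn in dH_lt_dm.
  by rewrite ltnNge ltnW.
apply: (noHC m); last by rewrite H_lt_m.
split=> // k k_gt0 k_lt_m; apply: leq_ltn_trans dH_lt_dm.
exact: IHm k_lt_m k_gt0 (ltn_trans k_lt_m m_ltH').
Qed.

Definition lattice_between (x y z : nat) : Prop :=
  forall p, minn (logn p x) (logn p y) <= logn p z <= maxn (logn p x) (logn p y).

(** Each exponent of [z] is at most the maximum, hence at most the sum, of those of [x] and [y]; so
    [z] divides [x * y]. *)
Lemma exists_complement x y z : 0 < x -> 0 < y -> 0 < z ->
  lattice_between x y z -> exists2 w, 0 < w & z * w = x * y.
Proof.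
move=> x_gt0 y_gt0 z_gt0 xyz.
have /dvdnP[w xyE] : z %| x * y.
  apply/dvdn_partP => // p; rewrite mem_primes p_part => /and3P[p_pr _ _].
  rewrite pfactor_dvdn ?muln_gt0 ?x_gt0 // lognM //; have := xyz p; lia.
by exists w; [have := muln_gt0 x y; rewrite xyE muln_gt0 x_gt0 y_gt0 => /andP[]
             | rewrite mulnC].
Qed.

Lemma leq_mul_between a b c e : c + e = a + b ->
  minn a b <= c <= maxn a b -> a.+1 * b.+1 <= c.+1 * e.+1.
Proof.
wlog ab : a b / a <= b => [Hwlog sumE abc | sumE abc].
  have [ab|/ltnW ba] := leqP a b; first exact: Hwlog.
  by rewrite mulnC; apply: Hwlog => //; lia.
(* With [c = a + s], [e = a + t] and [b = a + s + t], the two sides differ by exactly [s * t]. *)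
have [s cE] : exists s, c = a + s by exists (c - a); lia.
have [t eE] : exists t, e = a + t by exists (e - a); lia.
have bE : b = a + s + t by lia.
by rewrite {}bE {}cE {}eE; clear; nia.
Qed.

Lemma num_divisors_complement x y z w : 0 < x -> 0 < y -> 0 < z -> 0 < w ->
  lattice_between x y z -> z * w = x * y ->
  num_divisors x * num_divisors y <= num_divisors z * num_divisors w.
Proof.
move=> x_gt0 y_gt0 z_gt0 w_gt0 xyz zwE.
pose N := (x + y + z + w).+1.
rewrite !(@num_divisorsE N) /N -?big_split /=; try lia.
apply: leq_prod => p _.
have : logn p z + logn p w = logn p x + logn p y by rewrite -!lognM // zwE.
by move/leq_mul_between; apply.
Qed.

Lemma lattice_between_consecutive H H' z :
  consecutive_hc H H' -> 0 < z -> lattice_between H H' z -> z < H' ->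
  z <= H.
Proof.
move=> cons z_gt0 Hz z_ltH'; rewrite leqNgt; apply/negP => H_ltz.
have [[H_gt0 _] [H'_gt0 H'_hc] H_ltH' _] := cons.
have [w w_gt0 zwE] := exists_complement H_gt0 H'_gt0 z_gt0 Hz.
have w_ltH' : w < H' by nia.
have := num_divisors_complement H_gt0 H'_gt0 z_gt0 w_gt0 Hz zwE.
have := num_divisors_consecutive cons z_gt0 z_ltH'.
have := num_divisors_consecutive cons w_gt0 w_ltH'.
have := H'_hc H H_gt0 H_ltH'; have := num_divisors_gt0 H_gt0.
nia.
Qed.

Lemma logn_nonprime p n : ~~ prime p -> logn p n = 0.
Proof. by rewrite lognE => /negPf ->. Qed.

Lemma logn_succ_eq_mul p x y : prime p -> 0 < x -> 0 < y ->
  logn p y = (logn p x).+1 ->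
  (forall q, prime q -> q != p -> logn q y = logn q x) -> y = x * p.
Proof.
move=> p_pr x_gt0 y_gt0 yp yq; have p_gt0 := prime_gt0 p_pr.
apply: eqn_from_log => [//||q]; first by rewrite muln_gt0 x_gt0.
rewrite lognM // (logn_prime q p_pr).
case: (eqVneq q p) => [->|q_neq_p]; first by rewrite yp ?eqxx addn1.
rewrite addn0; have [q_pr|q_npr] := boolP (prime q); first exact: yq.
by rewrite !logn_nonprime.
Qed.

Lemma exponent_step_move T x y : 0 < x -> 0 < y -> exponent_step T x y ->
  insertion x y \/ deletion x y.
Proof.
move=> x_gt0 y_gt0 [p p_pr [yq [[_ yp] | [_ xp]]]].
  by left; exists p => //; apply: logn_succ_eq_mul.
right; exists p => //; apply: logn_succ_eq_mul => // q q_pr q_neq_p.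
by rewrite yq.
Qed.

Lemma insertion_ltn x y : 0 < x -> insertion x y -> x < y.
Proof. by move=> x_gt0 [p p_pr ->]; rewrite ltn_Pmulr // prime_gt1. Qed.

Lemma deletion_gtn x y : 0 < y -> deletion x y -> y < x.
Proof. by move=> y_gt0 [p p_pr ->]; rewrite ltn_Pmulr // prime_gt1. Qed.

Lemma exponent_step_between T x y : exponent_step T x y -> lattice_between x T y.
Proof.
case=> p p_pr [yq yp] q; have [->|q_neq_p] := eqVneq q p; first by lia.
have [q_pr|q_npr] := boolP (prime q); first by rewrite yq //; lia.
by rewrite !logn_nonprime.
Qed.

(** The step brings the exponent of [p] strictly closer to its target, so the range left between [y]
    and [T] misses the exponent of [x]. Hence a geodesic never returns to a vertex it has left. *)
Lemma exponent_step_leaves T x y z :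
  exponent_step T x y -> lattice_between y T z -> z <> x.
Proof. by case=> p _ [_ yp] /(_ p) yz zx; rewrite zx in yz; lia. Qed.

Lemma exponent_step_target T y : ~ exponent_step T T y.
Proof. by case=> p _ [_]; rewrite !ltnn => -[[]|[]]. Qed.

(** Each step stays between the current vertex and the target, and these nested ranges compose along
    the path. *)
Lemma geodesic_between H H' g i j : geodesic H H' g -> i <= j -> j < size g ->
  lattice_between (vertex g i) H' (vertex g j).
Proof.
case=> [_ _ _ _ step]; elim: j => [|j IHj] i_le_j j_lt p.
  by move: i_le_j; rewrite leqn0 => /eqP ->; lia.
move: i_le_j; rewrite leq_eqVlt => /orP[/eqP -> | i_le_j]; first by lia.
have := IHj i_le_j (ltnW j_lt) p.
by have := exponent_step_between (step j j_lt) p; lia.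
Qed.

Lemma geodesic_interior H H' g i :
  consecutive_hc H H' -> geodesic H H' g -> admissible H' g ->
  0 < i -> i < (size g).-1 -> vertex g i < H.
Proof.
move=> cons geo adm i_gt0 i_lt; have [_ g0 _ g_gt0 step] := geo.
have i1_lt : i.+1 < size g by lia.
have i_lts := ltnW i1_lt; have one_lt : 1 < size g by lia.
(* No step can start at the target, whereas an interior vertex has a successor. *)
have neqH' : vertex g i <> H'.
  by move=> giE; apply: (@exponent_step_target H' (vertex g i.+1));
     rewrite -{2}giE; apply: step.
have neqH : vertex g i <> H.
  rewrite -g0; apply: exponent_step_leaves (step 0 one_lt) _.
  exact: geodesic_between geo i_gt0 i_lts.
have bet : lattice_between H H' (vertex g i).
  by rewrite -g0; apply: geodesic_between geo _ i_lts.
have lt_H' : vertex g i < H' by have := adm i i_lts; lia.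
by have := lattice_between_consecutive cons (g_gt0 i i_lts) bet lt_H'; lia.
Qed.

Unset Implicit Arguments.

Theorem corollary4p3 (H H' : nat) (g : seq nat) :
  consecutive_hc H H' ->
  geodesic H H' g ->
  admissible H' g ->
  (forall i, 0 < i -> i < (size g).-1 ->
     vertex g i < H /\ num_divisors (vertex g i) < num_divisors H) /\
  (has_move deletion g -> has_move insertion g ->
     deletion (vertex g 0) (vertex g 1) /\
     insertion (vertex g (size g).-2) (vertex g (size g).-1)).
Proof.
move=> cons geo adm; have [_ g0 glast g_gt0 step] := geo.
have [[H_gt0 H_hc] _ H_ltH' _] := cons.
have interior i := @geodesic_interior H H' g i cons geo adm.
split=> [i i_gt0 i_lt | [i i_lt del] [j j_lt ins]].
  have gi_lt := interior i i_gt0 i_lt; split=> //.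
  by apply: H_hc gi_lt; apply: g_gt0; lia.
(* With a single move, the deletion and the insertion would coincide, so that move would both
   decrease and increase its vertex. *)
have size_gt2 : 2 < size g.
  rewrite ltnNge; apply/negP => size_le2.
  have [i0 j0] : i = 0 /\ j = 0 by lia.
  have := deletion_gtn (g_gt0 _ i_lt) del.
  by have := insertion_ltn (g_gt0 _ (ltnW j_lt)) ins; rewrite i0 j0; lia.
have move_ k : k.+1 < size g -> insertion (vertex g k) (vertex g k.+1) \/
                                deletion (vertex g k) (vertex g k.+1).
  by move=> k_lt; apply: exponent_step_move (step k k_lt); apply: g_gt0; lia.
split.
  have one_lt := ltnW size_gt2.
  (* An initial insertion would put vertex 1, which is interior, above [H]. *)
  case: (move_ 0 one_lt) => // /(insertion_ltn (g_gt0 0 (ltnW one_lt))).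
  by have := interior 1 isT; rewrite g0; lia.
have sE : (size g).-2.+1 = (size g).-1 by lia.
(* A final deletion would put the penultimate vertex above [H'], although it is interior and so
   below [H]. *)
have := move_ (size g).-2; rewrite sE => -[|//|]; first by lia.
move/deletion_gtn; rewrite glast => /(_ (ltn_trans H_gt0 H_ltH')).
have : vertex g (size g).-2 < H by apply: interior; lia.
lia.
Qed.
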